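(* Let $q$ be a prime power, $n$ a positive integer, and suppose that $a\in\overline{\mathbb{F}}_q$ is a primitive $(q^s+1)$-st root of $1$ for some positive integer $s$. Then $\epsilon_a(G^\tau)=\mathrm{SU}_{2n}(q^s)$.
   Context: Let $\mathbb{F}_q[t,t^{-1}]$ be the ring of Laurent polynomials over the finite field $\mathbb{F}_q$, and let $\sigma$ be the ring automorphism of $\mathbb{F}_q[t,t^{-1}]$ fixing every element of $\mathbb{F}_q$ and interchanging $t$ and $t^{-1}$. Let $V$ be the free $\mathbb{F}_q[t,t^{-1}]$-module of rank $2n$ with basis $e_1,\dots,e_n,f_1,\dots,f_n$. Let $\beta:V\times V\to\mathbb{F}_q[t,t^{-1}]$ be the $\sigma$-sesquilinear form (linear in the first coordinate, and $\beta(u,\lambda v+w)=\sigma(\lambda)\beta(u,v)+\beta(u,w)$ for $u,v,w\in V$, $\lambda\in\mathbb{F}_q[t,t^{-1}]$) determined by $\beta(e_i,e_j)=\beta(f_i,f_j)=0$, $\beta(e_i,f_j)=t\,\delta_{ij}$, $\beta(f_i,e_j)=\delta_{ij}$ for all $1\le i,j\le n$. Define $$G^\tau=\{g\in \mathrm{SL}_{2n}(\mathbb{F}_q[t,t^{-1}])\mid \beta(gx,gy)=\beta(x,y)\ \text{for all } x,y\in V\},$$ where matrices act on $V$ via the given basis. For $a\in\overline{\mathbb{F}}_q^{*}$ (where $\overline{\mathbb{F}}_q$ is an algebraic closure of $\mathbb{F}_q$), $\epsilon_a:\mathbb{F}_q[t,t^{-1}]\to\overline{\mathbb{F}}_q$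 is the specialization $f\mapsto f(a)$, and $\epsilon_a:\mathrm{SL}_{2n}(\mathbb{F}_q[t,t^{-1}])\to\mathrm{SL}_{2n}(\mathbb{F}_q(a))$ also denotes the induced (entrywise) homomorphism. When $a$ is a primitive $(q^s+1)$-st root of $1$, one has $\mathbb{F}_q(a)=\mathbb{F}_{q^{2s}}$, and $\lambda\mapsto\bar\lambda=\lambda^{q^s}$ is the Galois automorphism with $\bar a=a^{-1}$. Let $\tilde V=V\otimes_{\mathbb{F}_q[t,t^{-1}]}\mathbb{F}_q(a)$ (via $\epsilon_a$), with basis $\tilde e_i,\tilde f_i$, and let $\tilde\beta$ be the evaluation of $\beta$ at $t=a$, i.e. the form that is linear in the first coordinate and $\bar{\ }$-semilinear in the second, with $\tilde\beta(\tilde e_i,\tilde e_j)=\tilde\beta(\tilde f_i,\tilde f_j)=0$, $\tilde\beta(\tilde e_i,\tilde f_j)=a\,\delta_{ij}$, $\tilde\beta(\tilde f_i,\tilde e_j)=\delta_{ij}$. Here $\mathrm{SU}_{2n}(q^s)$ is the special unitary group realized as $\{g\in\mathrm{SL}_{2n}(\mathbb{F}_q(a))\mid\tilde\beta(gx,gy)=\tilde\beta(x,y)\text{ for all }x,y\in\tilde V\}$ ($\tilde\beta$ is a scalar multiple of a non-degenerate Hermitian form). *)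

(* Defs.v *)
From HB Require Import structures.
From mathcomp Require Import all_boot all_algebra.
From mathcomp Require Import finmap.
From mathcomp Require Import boolp classical_sets.
From mathcomp Require Import monalg.

Set Implicit Arguments.
Unset Strict Implicit.
Unset Printing Implicit Defensive.

Import GRing.Theory.

Local Open Scope classical_set_scope.
Local Open Scope ring_scope.

(* R[t, t^-1], as finitely supported functions int -> R; the coefficient of
   t ^ k in f is f@_k, and << c *g k >> is the monomial c * t ^ k. The product
   is defined here because the one of monalg.v requires the exponents to form
   a monoid without nontrivial units, which excludes int. *)
Definition laurent (R : comNzRingType) : Type := {malg R[int]}.

HB.instance Definition _ (R : comNzRingType) := GRing.Zmodule.on (laurent R).

Section LaurentRing.
Variable R : comNzRingType.
Implicit Types (f g h : laurent R) (c : R) (k : int).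

Definition lmono c k : laurent R := << c *g k >>.

Definition laurent_one : laurent R := lmono 1 0.

Definition laurent_mul f g : laurent R :=
  \sum_(i <- msupp f) \sum_(j <- msupp g) lmono (f@_i * g@_j) (i + j).

Lemma lmonoD c d k : lmono (c + d) k = lmono c k + lmono d k.
Proof. exact: monalgUD. Qed.

Lemma lmono0 k : lmono 0 k = 0.
Proof. exact: monalgU0. Qed.

Lemma laurent_ind (P : laurent R -> Prop) :
  P 0 -> (forall f g, P f -> P g -> P (f + g)) -> (forall c k, P (lmono c k)) ->
  forall f, P f.
Proof.
move=> P0 PD PU f; rewrite [f](@monalgE int R).
by elim/big_ind: _ => // i _; apply: PU.
Qed.

Lemma lsumEw (V : zmodType) (Phi : int -> R -> V) f (d : {fset int}) :
  (forall k, Phi k 0 = 0) -> (msupp f `<=` d)%fset ->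
  \sum_(k <- msupp f) Phi k f@_k = \sum_(k <- d) Phi k f@_k.
Proof.
move=> Phi0 le; rewrite [LHS](big_fset_incl _ le) => //= x _ /mcoeff_outdom ->.
exact: Phi0.
Qed.

Lemma lsumD (V : zmodType) (Phi : int -> R -> V) f g :
  (forall k, Phi k 0 = 0) ->
  (forall k c d, Phi k (c + d) = Phi k c + Phi k d) ->
  \sum_(k <- msupp (f + g)) Phi k (f + g)@_k =
  \sum_(k <- msupp f) Phi k f@_k + \sum_(k <- msupp g) Phi k g@_k.
Proof.
move=> Phi0 PhiD; pose d := (msupp f `|` msupp g)%fset.
rewrite (@lsumEw _ Phi (f + g) d) ?msuppD_le //.
rewrite (@lsumEw _ Phi f d) ?fsubsetUl // (@lsumEw _ Phi g d) ?fsubsetUr //.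
rewrite -big_split /=; apply: eq_bigr => k _.
by rewrite -PhiD; congr (Phi k _); apply: mcoeffD.
Qed.

Lemma lsumU (V : zmodType) (Phi : int -> R -> V) c k :
  (forall k, Phi k 0 = 0) ->
  \sum_(i <- msupp (lmono c k)) Phi i (lmono c k)@_i = Phi k c.
Proof.
move=> Phi0; rewrite (@lsumEw _ Phi _ [fset k]%fset) ?msuppU_le //.
by rewrite big_seq_fset1 mcoeffUU.
Qed.

Lemma laurent_mulC : commutative laurent_mul.
Proof.
move=> f g; rewrite /laurent_mul exchange_big /=.
by do 2!apply: eq_bigr => ? _; rewrite mulrC addrC.
Qed.

Lemma laurent_mulDl : left_distributive laurent_mul +%R.
Proof.
move=> f g h; apply: (@lsumD _ (fun i c =>
  \sum_(j <- msupp h) lmono (c * h@_j) (i + j))) => [k|k c d].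
  by apply: big1 => j _; rewrite mul0r lmono0.
by rewrite -big_split; apply: eq_bigr => j _; rewrite mulrDl lmonoD.
Qed.

Lemma laurent_mulDr : right_distributive laurent_mul +%R.
Proof. by move=> f g h; rewrite laurent_mulC laurent_mulDl !(laurent_mulC f). Qed.

Lemma laurent_mulUU c d i j :
  laurent_mul (lmono c i) (lmono d j) = lmono (c * d) (i + j).
Proof.
rewrite /laurent_mul (@lsumU _ (fun i c =>
  \sum_(k <- msupp (lmono d j)) lmono (c * (lmono d j)@_k) (i + k))).
  by rewrite (@lsumU _ (fun k e => lmono (c * e) (i + k))) // => k;
     rewrite mulr0 lmono0.
by move=> k; apply: big1 => l _; rewrite mul0r lmono0.
Qed.

Lemma laurent_mul0r : left_zero 0 laurent_mul.
Proof. by move=> f; rewrite /laurent_mul msupp0 big_seq_fset0. Qed.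

Lemma laurent_mulr0 : right_zero 0 laurent_mul.
Proof. by move=> f; rewrite laurent_mulC laurent_mul0r. Qed.

Lemma laurent_mulA : associative laurent_mul.
Proof.
move=> f g h; elim/laurent_ind: f => [|f1 f2 IH1 IH2|c i].
- by rewrite !laurent_mul0r.
- by rewrite !laurent_mulDl IH1 IH2.
elim/laurent_ind: g => [|g1 g2 IH1 IH2|d j].
- by rewrite laurent_mul0r laurent_mulr0 laurent_mul0r.
- by rewrite laurent_mulDl !laurent_mulDr laurent_mulDl IH1 IH2.
elim/laurent_ind: h => [|h1 h2 IH1 IH2|e k].
- by rewrite !laurent_mulr0.
- by rewrite !laurent_mulDr IH1 IH2.
by rewrite !laurent_mulUU mulrA addrA.
Qed.

Lemma laurent_mul1r : left_id laurent_one laurent_mul.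
Proof.
elim/laurent_ind => [|f g IHf IHg|c k]; first exact: laurent_mulr0.
  by rewrite laurent_mulDr IHf IHg.
by rewrite laurent_mulUU mul1r add0r.
Qed.

Lemma laurent_one_neq0 : laurent_one != 0.
Proof. by rewrite monalgU_eq0 oner_eq0. Qed.

HB.instance Definition _ := GRing.Zmodule_isComNzRing.Build (laurent R)
  laurent_mulA laurent_mulC laurent_mul1r laurent_mulDl laurent_one_neq0.

Lemma lmonoM c d i j : lmono c i * lmono d j = lmono (c * d) (i + j).
Proof. exact: laurent_mulUU. Qed.

Definition laurentX : laurent R := lmono 1 1.

(* sigma : the automorphism fixing R and exchanging t and t^-1 *)
Definition laurent_conj f : laurent R :=
  \sum_(k <- msupp f) lmono f@_k (- k).

Lemma laurent_conj_lmono c k : laurent_conj (lmono c k) = lmono c (- k).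
Proof. by apply: (@lsumU _ (fun k c => lmono c (- k))) => i; apply: lmono0. Qed.

Lemma laurent_conjD : {morph laurent_conj : f g / f + g}.
Proof.
move=> f g; apply: (@lsumD _ (fun k c => lmono c (- k))) => [k|k c d].
  exact: lmono0.
exact: lmonoD.
Qed.

Lemma laurent_conj0 : laurent_conj 0 = 0.
Proof. by rewrite /laurent_conj msupp0 big_seq_fset0. Qed.

Lemma laurent_conj_nmod : nmod_morphism laurent_conj.
Proof. split; [exact: laurent_conj0 | exact: laurent_conjD]. Qed.

Lemma laurent_conj_monoid : monoid_morphism laurent_conj.
Proof.
split=> [|f g]; first by rewrite [LHS]laurent_conj_lmono oppr0.
elim/laurent_ind: f => [|f1 f2 IH1 IH2|c i].
- by rewrite laurent_conj0 !mul0r laurent_conj0.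
- by rewrite mulrDl !laurent_conjD IH1 IH2 mulrDl.
elim/laurent_ind: g => [|g1 g2 IH1 IH2|d j].
- by rewrite laurent_conj0 !mulr0 laurent_conj0.
- by rewrite mulrDr !laurent_conjD IH1 IH2 mulrDr.
by rewrite lmonoM !laurent_conj_lmono lmonoM opprD.
Qed.

HB.instance Definition _ := GRing.isNmodMorphism.Build (laurent R) (laurent R)
  laurent_conj laurent_conj_nmod.
HB.instance Definition _ := GRing.isMonoidMorphism.Build (laurent R) (laurent R)
  laurent_conj laurent_conj_monoid.

Lemma laurent_conjK : involutive laurent_conj.
Proof.
elim/laurent_ind => [|f g IHf IHg|c k]; first by rewrite !laurent_conj0.
  by rewrite !laurent_conjD IHf IHg.
by rewrite !laurent_conj_lmono opprK.
Qed.

End LaurentRing.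

(* epsilon_a : f |-> f(a), the coefficients being mapped to K by iota; it is
   meaningful only for a != 0, since 0 ^ k = 0 for k < 0 in a unit ring *)
Definition laurent_eval (F K : fieldType) (iota : F -> K) (a : K)
    (f : laurent F) : K :=
  \sum_(k <- msupp f) iota f@_k * a ^ k.

Section LaurentEval.
Variables (F K : fieldType) (iota : {rmorphism F -> K}) (a : K).

Lemma laurent_eval_lmono c k : laurent_eval iota a (lmono c k) = iota c * a ^ k.
Proof.
by apply: (@lsumU _ _ (fun k c => iota c * a ^ k)) => i; rewrite rmorph0 mul0r.
Qed.

Lemma laurent_eval_nmod : nmod_morphism (laurent_eval iota a).
Proof.
split=> [|f g]; first by rewrite /laurent_eval msupp0 big_seq_fset0.
apply: (@lsumD _ _ (fun k c => iota c * a ^ k)) => [k|k c d].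
  by rewrite rmorph0 mul0r.
by rewrite rmorphD mulrDl.
Qed.

Lemma laurent_eval_monoid : a != 0 -> monoid_morphism (laurent_eval iota a).
Proof.
have [ev0 evD] := laurent_eval_nmod.
move=> a_neq0; split=> [|f g].
  by rewrite [LHS]laurent_eval_lmono rmorph1 mul1r expr0z.
elim/laurent_ind: f => [|f1 f2 IH1 IH2|c i].
- by rewrite ev0 !mul0r ev0.
- by rewrite mulrDl !evD IH1 IH2 mulrDl.
elim/laurent_ind: g => [|g1 g2 IH1 IH2|d j].
- by rewrite ev0 !mulr0 ev0.
- by rewrite mulrDr !evD IH1 IH2 mulrDr.
by rewrite lmonoM !laurent_eval_lmono rmorphM expfzDr // mulrACA.
Qed.

End LaurentEval.

(* The form on column vectors, linear in x and bar-semilinear in y, where the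
   first n coordinates are those along the e_i and the last n along the f_i:
   (e_i, f_j) |-> c * delta_ij and (f_i, e_j) |-> delta_ij. *)
Definition sform (R : comNzRingType) (bar : R -> R) (c : R) (n : nat)
    (x y : 'cV[R]_(n + n)) : R :=
  (x^T *m block_mx 0 c%:M 1%:M 0 *m map_mx bar y) 0 0.

Definition Gtau (F : fieldType) (n : nat) : set 'M[laurent F]_(n + n) :=
  [set g | \det g = 1 /\
    forall x y : 'cV[laurent F]_(n + n),
      sform (@laurent_conj F) (laurentX F) (g *m x) (g *m y) =
      sform (@laurent_conj F) (laurentX F) x y].

Arguments Gtau : clear implicits.

(* F(a) : the smallest subfield of K containing iota(F) and a *)
Definition adjoin (F K : fieldType) (iota : F -> K) (a : K) : {pred K} :=
  fun x => `[< forall S : {pred K}, divring_closed S ->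
                 (forall c, iota c \in S) -> a \in S -> x \in S >].

(* SU_2n(r) for r = q ^ s, as matrices and vectors over K with all their
   entries in F(a) = F_(r ^ 2), on which the involution is y |-> y ^ r *)
Definition SU (F K : fieldType) (iota : F -> K) (a : K) (n r : nat) :
    set 'M[K]_(n + n) :=
  [set g | [/\ g \is a mxOver (adjoin iota a), \det g = 1 &
    forall x y : 'cV[K]_(n + n),
      x \is a mxOver (adjoin iota a) -> y \is a mxOver (adjoin iota a) ->
      sform (fun z => z ^+ r) a (g *m x) (g *m y) =
      sform (fun z => z ^+ r) a x y]].

Arguments SU {F K} iota a n r _.

(* Main.v *)
(* Specialization at t = a maps F[t, t^-1] onto E = F(a) and turns sigma into
   the involution bar : y |-> y ^ (q ^ s) of E, so only the lifting of an
   element g = [A B; C D] of SU over E is at stake. Since g is invertible and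
   its first n columns span an isotropic space, some skew-hermitian S makes
   A + S C invertible; after multiplying by [1 S; 0 1], g lies in the big cell:
   it is a product of a lower unipotent, a Levi element diag(A, (bar A)^-T)
   with bar (det A) = det A, and an upper unipotent. Unipotents lift because
   every skew-hermitian matrix over E is the skew-symmetrization of some
   matrix. The Levi part lifts because A = T D with T in SL_n(E), which lifts
   by elimination, and D a diagonal matrix fixed by bar, whose Levi element is
   a product of two Weyl elements, hence of unipotents. *)
Require Import Defs.
From HB Require Import structures.
From mathcomp Require Import all_boot all_algebra pgroup finfield.
From mathcomp Require Import boolp classical_sets.
From mathcomp Require Import ring.

Set Implicit Arguments.
Unset Strict Implicit.
Unset Printing Implicit Defensive.

Import GRing.Theory.
Local Open Scope classical_set_scope.
Local Open Scope ring_scope.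

(** * The unitary group as a group of block matrices *)

Definition gram (R : comNzRingType) (c : R) n : 'M[R]_(n + n) :=
  block_mx 0 c%:M 1%:M 0.

Definition unitary (R : comNzRingType) (bar : R -> R) (c : R) n
    (g : 'M[R]_(n + n)) : Prop :=
  g^T *m gram c n *m map_mx bar g = gram c n.

Section UnitaryGroup.
Variables (R : comNzRingType) (bar : {rmorphism R -> R}) (c : R) (n : nat).
Implicit Types g h : 'M[R]_(n + n).
Implicit Types A B C D : 'M[R]_n.

Lemma unitaryM g h :
  unitary bar c g -> unitary bar c h -> unitary bar c (g *m h).
Proof.
move=> Ug Uh; rewrite /unitary trmx_mul map_mxM.
transitivity (h^T *m (g^T *m gram c n *m map_mx bar g) *m map_mx bar h).
  by rewrite !mulmxA.
by rewrite Ug.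
Qed.

Lemma unitary_sform g x y :
  unitary bar c g -> sform bar c (g *m x) (g *m y) = sform bar c x y.
Proof.
move=> Ug; rewrite /sform trmx_mul map_mxM -[block_mx _ _ _ _]/(gram c n).
by rewrite -[in RHS]Ug !mulmxA.
Qed.

(** On basis vectors the form reads off the entries of [g^T *m gram c n *m map_mx bar g] and of
    [gram c n], so these finitely many tests determine the matrix identity. *)
Lemma sform_unitary g :
  (forall i j : 'I_(n + n),
    sform bar c (g *m delta_mx i 0) (g *m delta_mx j 0) =
    sform bar c (delta_mx i 0) (delta_mx j 0)) ->
  unitary bar c g.
Proof.
have sE (M : 'M[R]_(n + n)) i j :
    ((delta_mx i 0 : 'cV_(n + n))^T *m M *m delta_mx j (0 : 'I_1)) 0 0 = M i j.
  by rewrite trmx_delta -rowE -colE !mxE.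
move=> Hg; apply/matrixP=> i j; have := Hg i j.
rewrite /sform trmx_mul !map_mxM !map_delta_mx -[block_mx _ _ _ _]/(gram c n).
by rewrite sE => <-; rewrite -sE !mulmxA.
Qed.

(** The first equation involves only [A] and [C]: it is the isotropy of the span of the first [n]
    columns. *)
Lemma unitary_blockP A B C D :
  unitary bar c (block_mx A B C D) <->
  [/\ C^T *m map_mx bar A + c *: (A^T *m map_mx bar C) = 0,
      C^T *m map_mx bar B + c *: (A^T *m map_mx bar D) = c%:M,
      D^T *m map_mx bar A + c *: (B^T *m map_mx bar C) = 1%:M &
      D^T *m map_mx bar B + c *: (B^T *m map_mx bar D) = 0].
Proof.
rewrite /unitary /gram tr_block_mx map_block_mx !mulmx_block.
rewrite !mulmx0 !mulmx1 !mul_mx_scalar !add0r !addr0 -!scalemxAl.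
by split=> [/eq_block_mx|[-> -> -> ->]].
Qed.

Definition umx B : 'M[R]_(n + n) := block_mx 1%:M B 0 1%:M.
Definition lmx C : 'M[R]_(n + n) := block_mx 1%:M 0 C 1%:M.

Lemma unitary_umx B : map_mx bar B + c *: B^T = 0 -> unitary bar c (umx B).
Proof.
move=> HB; apply/unitary_blockP.
rewrite !trmx1 !trmx0 !map_mx1 !map_mx0 !mul0mx !mulmx0 !mul1mx !mulmx1.
by rewrite !scaler0 !addr0 add0r scalemx1; split.
Qed.

Lemma unitary_lmx C : C^T + c *: map_mx bar C = 0 -> unitary bar c (lmx C).
Proof.
move=> HC; apply/unitary_blockP.
rewrite !trmx1 !trmx0 !map_mx1 !map_mx0 !mul0mx !mulmx0 !mul1mx !mulmx1.
by rewrite !scaler0 !addr0 add0r scalemx1; split.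
Qed.

Lemma det_umx B : \det (umx B) = 1.
Proof. by rewrite det_ublock !det1 mulr1. Qed.

Lemma det_lmx C : \det (lmx C) = 1.
Proof. by rewrite det_lblock !det1 mulr1. Qed.

End UnitaryGroup.

(** * Lifting [SL_n] along a ring surjection onto a field *)

Section LiftSL.
Variables (R : comNzRingType) (E : fieldType) (ev : {rmorphism R -> E}).
Hypothesis ev_surj : forall x, exists p, ev p = x.

Lemma map_mx_surj m n (A : 'M[E]_(m, n)) : exists P, map_mx ev P = A.
Proof.
exists (\matrix_(i, j) sval (cid (ev_surj (A i j)))).
by apply/matrixP=> i j; rewrite !mxE; case: cid.
Qed.

Let liftable n (A : 'M[E]_n) := exists2 P, \det P = 1 & map_mx ev P = A.

Let liftableM n (A B : 'M[E]_n) :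
  liftable A -> liftable B -> liftable (A *m B).
Proof.
move=> [P dP <-] [Q dQ <-]; exists (P *m Q); rewrite ?map_mxM //.
by rewrite det_mulmx dP dQ mulr1.
Qed.

Let liftable_u m n (v : 'M[E]_(m, n)) : liftable (block_mx 1%:M v 0 1%:M).
Proof.
have [V <-] := map_mx_surj v; exists (block_mx 1%:M V 0 1%:M).
  by rewrite det_ublock !det1 mulr1.
by rewrite map_block_mx !map_mx1 map_mx0.
Qed.

Let liftable_l m n (w : 'M[E]_(m, n)) : liftable (block_mx 1%:M 0 w 1%:M).
Proof.
have [W <-] := map_mx_surj w; exists (block_mx 1%:M 0 W 1%:M).
  by rewrite det_lblock !det1 mulr1.
by rewrite map_block_mx !map_mx1 map_mx0.
Qed.

Let liftable_r m n (B : 'M[E]_n) : liftable B ->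
  liftable (block_mx (1%:M : 'M_m) 0 0 B).
Proof.
move=> [P dP <-]; exists (block_mx 1%:M 0 0 P).
  by rewrite det_ublock det1 mul1r.
by rewrite map_block_mx map_mx1 !map_mx0.
Qed.

(** Block unipotents lift entrywise and keep determinant 1. Multiplying by them brings the matrix,
    split as [1 + n.+1], to corner entry 1; its Schur complement then has determinant 1 and
    induction applies. *)
Lemma det1_lift n (A : 'M[E]_n) :
  \det A = 1 -> exists2 P, \det P = 1 & map_mx ev P = A.
Proof.
elim: n A => [|[|n] IHn] A dA.
- by exists 1%:M; rewrite ?det1 // map_mx1 [A]thinmx0 thinmx0.
- exists 1%:M; rewrite ?det1 // map_mx1 [A]mx11_scalar.
  by rewrite -(det_mx11 A) dA.
have corner1 v w (B : 'M_n.+1) :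
    \det (block_mx (1%:M : 'M_1) v w B) = 1 -> liftable (block_mx 1%:M v w B).
  have ->: block_mx 1%:M v w B = block_mx 1%:M 0 w 1%:M *m
      block_mx 1%:M 0 0 (B - w *m v) *m block_mx (1%:M : 'M_1) v 0 1%:M.
    rewrite !mulmx_block !mul1mx !mulmx1 !mulmx0 !mul0mx !addr0.
    by rewrite ?add0r ?mulmx1 ?mul1mx addrC subrK.
  rewrite !det_mulmx !det_ublock det_lblock !det1 !mul1r mulr1 => /IHn dB.
  by do 2?apply: liftableM => //; apply: liftable_r.
(* Since [w] is nonzero over a field, some row [x] has [x *m w = 1%:M - al]; adding [x] times the
   lower rows to the first row turns the corner into 1. *)
have corner (al : 'M_1) v w (B : 'M_n.+1) :
    w != 0 -> \det (block_mx al v w B) = 1 -> liftable (block_mx al v w B).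
  move=> w_neq0 dM.
  have [x xw] : exists x, x *m w = 1%:M - al.
    have /row_fullP[x xw]: row_full w.
      by rewrite /row_full eqn_leq rank_leq_col lt0n mxrank_eq0.
    by exists ((1%:M - al) *m x); rewrite -mulmxA xw mulmx1.
  have mulA y : block_mx 1%:M y 0 1%:M *m block_mx al v w B =
      block_mx (al + y *m w) (v + y *m B) w B.
    by rewrite mulmx_block !mul1mx !mul0mx !add0r.
  have ->: block_mx al v w B = block_mx 1%:M (- x) 0 1%:M *m
      (block_mx 1%:M x 0 1%:M *m block_mx al v w B).
    rewrite mulmxA mulmx_block !mul1mx !mulmx1 !mulmx0 !mul0mx.
    by rewrite !addr0 add0r subrr -scalar_mx_block mul1mx.
  apply: liftableM; first exact: liftable_u.
  rewrite mulA xw addrC subrK; apply: corner1.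
  have := congr1 determinant (mulA x).
  by rewrite xw addrC subrK det_mulmx dM det_ublock !det1 !mulr1 => <-.
suff block (al : 'M_1) v w (B : 'M_n.+1) :
    \det (block_mx al v w B) = 1 -> liftable (block_mx al v w B).
  by move: dA; rewrite -[A](@submxK _ 1 n.+1 1 n.+1); apply: block.
(* If [w = 0], then [al] is nonzero because the determinant is; adding the first row to every lower
   row makes the column below the corner nonzero. *)
clear A dA; move=> dA; have [w0|/corner] := eqVneq w 0; last exact.
have al_neq0 : al != 0.
  apply: contra_eq_neq dA => al0; rewrite w0 al0.
  by rewrite det_ublock det0 mul0r eq_sym oner_eq0.
pose y : 'M[E]_(n.+1, 1) := const_mx 1.
have yal_neq0 : y *m al != 0.
  rewrite [al]mx11_scalar mul_mx_scalar scaler_eq0 negb_or; apply/andP; split.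
    apply: contraNneq al_neq0 => al0.
    by rewrite [al]mx11_scalar al0 -scalemx1 scale0r.
  by apply/eqP=> /matrixP/(_ 0 0)/eqP; rewrite !mxE oner_eq0.
have mulA z : block_mx 1%:M 0 z 1%:M *m block_mx al v 0 B =
    block_mx al v (z *m al) (z *m v + B).
  by rewrite mulmx_block !mul1mx !mul0mx !addr0.
have ->: block_mx al v w B = block_mx 1%:M 0 (- y) 1%:M *m
    (block_mx 1%:M 0 y 1%:M *m block_mx al v 0 B).
  rewrite w0 mulmxA mulmx_block !mul1mx !mulmx1 !mulmx0 !mul0mx.
  by rewrite !addr0 add0r addNr -scalar_mx_block mul1mx.
apply: liftableM; first exact: liftable_l.
rewrite mulA; apply: corner => //; rewrite -mulA det_mulmx -w0 dA.
by rewrite det_lblock !det1 !mulr1.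
Qed.
End LiftSL.

(** * Lifting the unitary group along an abstract specialization [ev] that carries [sigma] to
    [bar] *)

Section LiftUnitary.
Variables (R : comNzRingType) (sigma : {rmorphism R -> R}) (t t' : R).
Variables (E : fieldType) (bar : {rmorphism E -> E}) (a : E).
Variable ev : {rmorphism R -> E}.
Hypotheses (sigmaK : involutive sigma) (tt' : t * t' = 1).
Hypothesis sigma_t : sigma t = t'.
Hypotheses (ev_surj : forall x, exists p, ev p = x) (ev_t : ev t = a).
Hypothesis ev_sigma : forall p, ev (sigma p) = bar (ev p).
Hypotheses (a_neq1 : a != 1) (a_neqN1 : 1 + a != 0).

Let barK : involutive bar.
Proof. by move=> x; have [p <-] := ev_surj x; rewrite -!ev_sigma sigmaK. Qed.

Let a_neq0 : a != 0.
Proof.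
rewrite -ev_t; have /eqP := congr1 ev tt'; apply: contraTneq => ev_t0.
by rewrite rmorphM rmorph1 ev_t0 mul0r eq_sym oner_neq0.
Qed.

Let ev_t' : ev t' = a^-1.
Proof.
apply: (mulfI a_neq0); rewrite mulfV // -ev_t.
by rewrite -[LHS]rmorphM tt' rmorph1.
Qed.

Let bar_a : bar a = a^-1.
Proof. by rewrite -{1}ev_t -ev_sigma sigma_t ev_t'. Qed.

Let sigma_t' : sigma t' = t.
Proof. by rewrite -sigma_t sigmaK. Qed.

Let barK_mx m n (A : 'M[E]_(m, n)) : map_mx bar (map_mx bar A) = A.
Proof. by apply/matrixP=> i j; rewrite !mxE barK. Qed.

Let map_ev_sigma m n (P : 'M[R]_(m, n)) :
  map_mx ev (map_mx sigma P) = map_mx bar (map_mx ev P).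
Proof. by apply/matrixP=> i j; rewrite !mxE ev_sigma. Qed.

(** * Unipotent, Weyl and Levi elements *)

Section FixedSize.
Variable n : nat.
Implicit Types (A B C D X : 'M[E]_n) (g : 'M[E]_(n + n)).

Let liftable g := exists2 G, \det G = 1 /\ unitary sigma t G & map_mx ev G = g.

Let skew X := map_mx bar X + a *: X^T = 0.

Let liftableM g h : liftable g -> liftable h -> liftable (g *m h).
Proof.
move=> [G [dG UG] <-] [H [dH UH] <-]; exists (G *m H); rewrite ?map_mxM //.
by rewrite det_mulmx dG dH mulr1; split=> //; apply: unitaryM.
Qed.

(* With mu = 1 / (1 + a), one has mu + bar mu = 1, so that a skew X is the
   skew-symmetrization mu X - a^-1 (bar (mu X))^T of mu X, which makes sense
   over R. *)
Let mu : E := (1 + a)^-1.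

Let bar_mu : bar mu = a * mu.
Proof.
rewrite fmorphV rmorphD rmorph1 bar_a /mu; field.
by rewrite a_neqN1 a_neq0.
Qed.

Lemma liftable_umx X : skew X -> liftable (umx X).
Proof.
move=> skX; have [P evP] := map_mx_surj ev_surj (mu *: X).
exists (umx (P - t' *: (map_mx sigma P)^T)).
  split; first exact: det_umx.
  apply: unitary_umx; apply/matrixP=> i j; rewrite !mxE rmorphB rmorphM sigmaK.
  by rewrite sigma_t' mulrBr mulrA tt'; ring.
rewrite map_block_mx !map_mx1 map_mx0; congr block_mx.
apply/matrixP=> i j; have /matrixP/(_ j i) := skX.
have evPE k l : ev (P k l) = mu * X k l.
  by have /matrixP/(_ k l) := evP; rewrite !mxE.
rewrite !mxE rmorphB rmorphM ev_sigma ev_t' !evPE rmorphM bar_mu.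
move=> /eqP; rewrite addr_eq0 => /eqP->; rewrite /mu; field.
by rewrite a_neq0 a_neqN1.
Qed.

(** For lower unipotents skewness reads [X = - a *: (map_mx bar X)^T], so the transposed term of the
    skew-symmetrization carries [t] where the upper case has [t']. *)
Lemma liftable_lmx X : X^T + a *: map_mx bar X = 0 -> liftable (lmx X).
Proof.
move=> skX; have [P evP] := map_mx_surj ev_surj (mu *: X).
exists (lmx (P - t *: (map_mx sigma P)^T)).
  split; first exact: det_lmx.
  apply: unitary_lmx; apply/matrixP=> i j; rewrite !mxE rmorphB rmorphM sigmaK.
  by rewrite sigma_t mulrBr mulrA tt'; ring.
rewrite map_block_mx !map_mx1 map_mx0; congr block_mx.
apply/matrixP=> i j; have /matrixP/(_ j i) := skX.
have evPE k l : ev (P k l) = mu * X k l.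
  by have /matrixP/(_ k l) := evP; rewrite !mxE.
rewrite !mxE rmorphB rmorphM ev_sigma ev_t !evPE rmorphM bar_mu.
move=> /eqP; rewrite addr_eq0 => /eqP->; rewrite /mu; field.
by rewrite a_neqN1.
Qed.

(** As in [SL_2], a Weyl element is a product of three unipotents. Inverting the skewness relation
    of [X] gives the one that the lower factor [- invmx X] must satisfy. *)
Lemma liftable_weyl X : X \in unitmx -> skew X ->
  liftable (block_mx 0 X (- invmx X) 0).
Proof.
move=> uX skX.
have ->: block_mx 0 X (- invmx X) 0 = umx X *m lmx (- invmx X) *m umx X.
  rewrite /umx /lmx !mulmx_block !mulmx1 !mul1mx !mulmx0 ?mul0mx !add0r.
  rewrite mulmxN mulmxV // subrr ?mul0mx mulNmx.
  by rewrite mulVmx // !add0r addr0 addNr.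
apply: liftableM; last exact: liftable_umx.
apply: liftableM; first exact: liftable_umx.
apply: liftable_lmx; move/eqP: skX; rewrite addr_eq0 => /eqP skX.
rewrite !raddfN /= map_invmx skX trmx_inv -[- (a *: X^T)]scaleNr invmxZ.
  by rewrite scalerA invrN mulrN mulfV // scaleN1r opprK addNr.
by rewrite unitmxZ ?unitmx_tr // unitrN unitfE.
Qed.

(** Once the span of the [e_i] is acted on by [A], invariance of the form forces the conjugate
    inverse transpose on the span of the [f_i]. *)
Definition levi A : 'M[E]_(n + n) := block_mx A 0 0 (map_mx bar (invmx A))^T.

Lemma leviM A B : A \in unitmx -> B \in unitmx ->
  levi (A *m B) = levi A *m levi B.
Proof.
move=> uA uB; rewrite /levi mulmx_block !mulmx0 !mul0mx !addr0 !add0r.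
have ->: invmx (A *m B) = invmx B *m invmx A.
  apply: (can_inj (mulKmx (_ : A *m B \in unitmx))); rewrite ?unitmx_mul ?uA //.
  by rewrite mulmxV ?unitmx_mul ?uA // -mulmxA mulKVmx // mulmxV.
by rewrite map_mxM trmx_mul.
Qed.

Lemma liftable_levi_SL A : \det A = 1 -> liftable (levi A).
Proof.
move=> dA; have [P dP evP] := det1_lift ev_surj dA.
(* Over the ring [R] the adjugate serves as the inverse of [P], because [\det P = 1]. *)
exists (block_mx P 0 0 (map_mx sigma (\adj P))^T); last first.
  rewrite map_block_mx !map_mx0 evP -map_trmx map_ev_sigma map_mx_adj evP.
  by rewrite /levi /invmx unitmxE dA unitr1 invr1 scale1r.
split.
  by rewrite det_ublock det_tr det_map_mx dP mul1r -[LHS]mul1r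
    -{1}(rmorph1 sigma) -{1}dP -rmorphM -det_mulmx mul_mx_adj dP det1 rmorph1.
apply/unitary_blockP.
rewrite !trmx0 !map_mx0 !mul0mx !mulmx0 !scaler0 !addr0 add0r trmxK.
rewrite -map_mxM mul_adj_mx dP map_mx1; split=> //.
rewrite map_trmx -map_mx_comp map_mx_id ?[in LHS]/=; last first.
  by move=> x /=; apply: sigmaK.
by rewrite -trmx_mul mul_adj_mx dP trmx1 scalemx1.
Qed.

(** A nonzero scalar with [bar b = - a * b]: its multiples of symmetric matrices fixed by [bar] are
    skew. *)
Let b : E := 1 - a^-1.

Let b_neq0 : b != 0.
Proof. by rewrite subr_eq0 eq_sym invr_eq1. Qed.

Let bar_b : bar b = - a * b.
Proof. by rewrite rmorphB rmorph1 fmorphV bar_a invrK /b; field. Qed.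

(* levi D is the product of the two Weyl elements of b D and - b 1 *)
Lemma liftable_levi_sym D : D \in unitmx -> D^T = D -> map_mx bar D = D ->
  liftable (levi D).
Proof.
move=> uD trD barD.
have ub : b \is a GRing.unit by rewrite unitfE.
have uN : - b \is a GRing.unit by rewrite unitrN.
have ->: levi D = block_mx 0 (b *: D) (- invmx (b *: D)) 0 *m
                  block_mx 0 (- b *: 1%:M) (- invmx (- b *: 1%:M)) 0.
  rewrite mulmx_block !mulmx0 !mul0mx !addr0 !add0r.
  rewrite (invmxZ (_ : b *: D \in unitmx)) ?unitmxZ //.
  rewrite (invmxZ (_ : - b *: 1%:M \in unitmx)) ?unitmxZ ?unitmx1 // invmx1.
  rewrite invrN !scaleNr opprK mulNmx mulmxN opprK.
  rewrite -!scalemxAl -!scalemxAr !mulmx1 !scalerA.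
  by rewrite mulfV // mulVf // !scale1r /levi map_invmx barD trmx_inv trD.
have skb X : X^T = X -> map_mx bar X = X -> forall e, bar e = - a * e ->
    skew (e *: X).
  by move=> trX barX e bare; rewrite /skew map_mxZ barX bare linearZ /= trX
    -scalerA -scalerDl addNr scale0r.
apply: liftableM; apply: liftable_weyl; rewrite ?unitmxZ ?unitmx1 //.
  exact: skb.
by apply: skb; rewrite ?trmx1 ?map_mx1 // rmorphN bar_b mulrN.
Qed.

Lemma liftable_levi A : A \in unitmx -> bar (\det A) = \det A ->
  liftable (levi A).
Proof.
(* The diagonal factor carries the whole determinant of [A] in its first entry, so the other factor
   has determinant 1. *)
move=> uA barA; pose d : 'rV_n := \row_j if j == 0%N :> nat then \det A else 1.
have dD : \det (diag_mx d) = \det A.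
  rewrite det_diag; under eq_bigr do rewrite mxE.
  (* For [n = 0] there is no first entry, but the determinant is then 1. *)
  clear d; case: n A {uA barA} => [|m] A; first by rewrite big_ord0 det_mx00.
  by rewrite big_ord_recl big1 ?mulr1.
have uD : diag_mx d \in unitmx by rewrite unitmxE dD.
rewrite -(mulmxKV uD A) leviM ?unitmx_mul ?uA ?unitmx_inv //.
apply: liftableM.
  by apply: liftable_levi_SL; rewrite det_mulmx det_inv dD mulrV.
apply: liftable_levi_sym; rewrite ?tr_diag_mx //.
rewrite map_diag_mx; congr diag_mx; apply/rowP=> j; rewrite !mxE.
by case: ifP => // _; rewrite rmorph1.
Qed.

(** * The big cell, and moving an arbitrary element into it *)

Lemma unitary_big_cell A B C D : A \in unitmx ->
  unitary bar a (block_mx A B C D) ->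
  let X := invmx A *m B in let Z := C *m invmx A in
  [/\ skew X, Z^T + a *: map_mx bar Z = 0 &
      block_mx A B C D = lmx Z *m levi A *m umx X].
Proof.
move=> uA UA X Z; have [HCA HCB HDA HDB] := (unitary_blockP _ _ _ _ _ _).1 UA.
have ubA : map_mx bar A \in unitmx by rewrite map_unitmx.
have skZ : Z^T + a *: map_mx bar Z = 0.
  (* Skewness of [Z] is the isotropy relation between [A] and [C], with [A] divided out on both
     sides. *)
  have := congr1 (fun M => invmx A^T *m M *m invmx (map_mx bar A)) HCA.
  rewrite mulmx0 mul0mx mulmxDr mulmxDl mulmxA mulmxK // -scalemxAr -scalemxAl.
  by rewrite mulKmx ?unitmx_tr // /Z trmx_mul trmx_inv map_mxM map_invmx.
have ZA : Z *m A = C by rewrite mulmxKV.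
have AX : A *m X = B by rewrite mulKVmx.
have skNZ : (- Z)^T + a *: map_mx bar (- Z) = 0.
  by rewrite !raddfN /= -opprD skZ oppr0.
(* Multiplying by [lmx (- Z)] clears [C]. In the block triangular unitary matrix that remains, one
   relation determines the lower right block [D'] and another says that [X] is skew. *)
have := unitaryM (unitary_lmx skNZ) UA.
rewrite mulmx_block !mul1mx !mul0mx !addr0 !mulNmx ZA addNr addrC.
move/unitary_blockP; rewrite trmx0 map_mx0 !mul0mx !mulmx0 scaler0 !addr0 add0r.
set D' := D - Z *m B => -[_ _ HDA' HDB'].
have D'E : D' = (map_mx bar (invmx A))^T.
  by rewrite -[D']trmxK map_invmx -[D'^T](mulmxK ubA) HDA' mul1mx.
split=> //; last first.
  rewrite /lmx /levi /umx !mulmx_block !mulmx0 !mul0mx !mul1mx !mulmx1.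
  rewrite !addr0 !add0r [A *m X]AX [Z *m A]ZA -D'E.
  by rewrite -[in C *m X]ZA -[_ *m X]mulmxA AX addrC subrK.
by move: HDB'; rewrite D'E trmxK map_trmx barK_mx -trmx_mul -/X -map_mxM.
Qed.

(* With C = L p U, p a partial identity, and A1 the matrix A in the matching
   bases, the block p A1 p is skew and S replaces it by the scalar b on the
   range of p; the other rows are independent since (A; C) has full rank. *)
Lemma skew_shift A C : C^T *m map_mx bar A + a *: (A^T *m map_mx bar C) = 0 ->
  (forall v : 'rV_n, v *m A^T = 0 -> v *m C^T = 0 -> v = 0) ->
  exists2 S, skew S & A + S *m C \in unitmx.
Proof.
move=> HAC kerAC; set L := col_ebase C; set U := row_ebase C.
pose p : 'M[E]_n := pid_mx (\rank C).
have uL : L \in unitmx := col_ebase_unit C.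
have uU : U \in unitmx := row_ebase_unit C.
have CE : C = L *m p *m U by rewrite mulmx_ebase.
have pp : p *m p = p by rewrite pid_mx_id // rank_leq_row.
have trp : p^T = p by rewrite tr_pid_mx.
have barp : map_mx bar p = p by rewrite map_pid_mx.
pose star (M : 'M[E]_n) := (map_mx bar M)^T.
pose A1 := star L *m A *m invmx U.
(* The isotropy relation in the bases where [C] becomes [p]. *)
have HA1 : a *: (A1^T *m p) = - (p *m map_mx bar A1).
  have := congr1 (fun M => (invmx U)^T *m M *m map_mx bar (invmx U)) HAC.
  rewrite mulmx0 mul0mx mulmxDr mulmxDl mulmxA -trmx_mul CE mulmxK //.
  rewrite -scalemxAr -scalemxAl !mulmxA.
  rewrite -[_ *m _ *m _ *m map_mx bar (invmx U)]mulmxA.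
  rewrite -map_mxM mulmxK // [map_mx bar (L *m p)]map_mxM barp.
  rewrite trmx_mul trp => /eqP; rewrite addrC addr_eq0 => /eqP HA1.
  rewrite /A1 /star !trmx_mul trmxK !map_mxM map_trmx barK_mx !mulmxA.
  by rewrite -!mulmxA in HA1 *.
(* The right side of [HA1] is a left multiple of the idempotent [p], hence so is [A1^T *m p]. *)
have pA1p : p *m A1^T *m p = A1^T *m p.
  by apply: (scalerI a_neq0); rewrite -mulmxA scalemxAr HA1 mulmxN mulmxA pp.
pose S1 := b *: p - p *m A1 *m p.
have skS1 : skew S1.
  rewrite /skew /S1 map_mxB map_mxZ barp bar_b linearB linearZ /= trp.
  rewrite 2!map_mxM barp 2!trmx_mul trp scalerBr (mulmxA p A1^T) pA1p.
  rewrite HA1 scalerA.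
  rewrite -mulmxA.
  have ->: p *m (map_mx bar A1 *m p) = p *m map_mx bar A1.
    by apply: oppr_inj; rewrite mulmxA -mulNmx -HA1 -scalemxAl -mulmxA pp HA1.
  by rewrite mulNr scaleNr opprK addrACA addNr addNr addr0.
exists (star (invmx L) *m S1 *m invmx L).
  have := congr1 (fun M => (invmx L)^T *m M *m map_mx bar (invmx L)) skS1.
  rewrite mulmx0 mul0mx /skew => <-.
  have starE M :
      star (invmx L) *m M *m invmx L = star (invmx L) *m (M *m invmx L).
    by rewrite mulmxA.
  rewrite starE map_mxM map_mxM trmx_mul trmx_mul /star trmxK map_trmx barK_mx.
  by rewrite !mulmxA mulmxDr mulmxDl -scalemxAr -scalemxAl.
have starL : star (invmx L) *m star L = 1%:M.
  by rewrite -trmx_mul -map_mxM mulmxV // map_mx1 trmx1.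
have S1p : S1 *m p = S1.
  by rewrite /S1 mulmxBl -scalemxAl -(mulmxA (p *m A1)) pp.
(* The outer factors are invertible, so it remains to show that [A1 + S1] is, by a kernel
   computation on its transpose. *)
have ->: A + star (invmx L) *m S1 *m invmx L *m C =
    star (invmx L) *m (A1 + S1) *m U.
  rewrite mulmxDr mulmxDl /A1 !mulmxA starL mul1mx mulmxKV //.
  by rewrite [in LHS]CE !mulmxA mulmxKV // -[_ *m S1 *m p]mulmxA S1p.
rewrite !unitmx_mul uU andbT unitmx_tr map_unitmx unitmx_inv uL /=.
rewrite -unitmx_tr -row_free_unit; apply: inj_row_free => v.
have MTE : (A1 + S1)^T = A1^T + b *: p - p *m A1^T *m p.
  rewrite /S1 linearD linearB linearZ /= trp addrA; congr (_ - _).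
  by rewrite trmx_mul [(p *m A1)^T]trmx_mul trp mulmxA.
(* By [pA1p], the product [(A1 + S1)^T *m p] collapses to [b *: p], and [b] is nonzero. *)
move=> vM; have vp : v *m p = 0.
  have := congr1 (fun M => M *m p) vM; rewrite /= mul0mx -mulmxA MTE.
  rewrite mulmxBl mulmxDl pA1p -scalemxAl pp -mulmxA pp addrAC subrr add0r.
  by rewrite -scalemxAr => /eqP; rewrite scaler_eq0 (negPf b_neq0) => /eqP.
have vA1 : v *m A1^T = 0.
  rewrite -[RHS]vM MTE mulmxBr mulmxDr -scalemxAr !mulmxA vp.
  by rewrite scaler0 !mul0mx subr0 addr0.
(* Back in the original bases, [v *m A1^T = 0] and [v *m p = 0] say that this row is killed by [A^T]
   and by [C^T]. *)
have: v *m (invmx U)^T = 0.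
  apply: kerAC.
    move: vA1; rewrite /A1 /star !trmx_mul trmxK !mulmxA => vA1.
    have uL' : map_mx bar L \in unitmx by rewrite map_unitmx.
    by apply: (can_inj (mulmxK uL')); rewrite mul0mx.
  by rewrite -mulmxA -trmx_mul CE mulmxK // trmx_mul trp mulmxA vp mul0mx.
move/(congr1 (fun M => M *m U^T)).
by rewrite mul0mx -mulmxA -trmx_mul mulmxV // trmx1 mulmx1.
Qed.

Lemma unitary_lift g : \det g = 1 -> unitary bar a g ->
  exists2 G, \det G = 1 /\ unitary sigma t G & map_mx ev G = g.
Proof.
rewrite -[g]submxK; set A := ulsubmx g; set B := ursubmx g.
set C := dlsubmx g; set D := drsubmx g => dg Ug.
have [HAC _ _ _] := (unitary_blockP _ _ _ _ _ _).1 Ug.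
have [|S skS uA] := skew_shift HAC.
  move=> v vA vC.
  (* The kernel condition of [skew_shift] holds because such a [v], padded with zeros, is killed by
     the invertible matrix [g^T]. *)
  have: row_mx v 0 *m (block_mx A B C D)^T = 0.
    by rewrite tr_block_mx mul_row_block !mul0mx !addr0 vA vC row_mx0.
  have ug : (block_mx A B C D)^T \in unitmx.
    by rewrite unitmx_tr unitmxE dg unitr1.
  rewrite -[RHS](mul0mx _ (block_mx A B C D)^T) => /(can_inj (mulmxK ug)).
  by move/eqP; rewrite row_mx_eq0 => /andP[/eqP].
have UA := unitaryM (unitary_umx skS) Ug.
have skNS : skew (- S).
  by rewrite /skew !raddfN /= -opprD skS oppr0.
have gE : block_mx A B C D = umx (- S) *m (umx S *m block_mx A B C D).
  rewrite mulmxA [umx _ *m umx _]mulmx_block !mulmx0 !mul0mx !mulmx1 !mul1mx.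
  rewrite !addr0 !add0r.
  by rewrite subrr -scalar_mx_block mul1mx.
rewrite gE; apply: liftableM; first exact: liftable_umx.
have: \det (umx S *m block_mx A B C D) = 1.
  by rewrite det_mulmx det_umx dg mulr1.
move: UA; rewrite mulmx_block !mul1mx !mul0mx !add0r => UA.
have [skX skZ ->] := unitary_big_cell uA UA.
(* The unipotent factors have determinant 1, so [\det A / bar (\det A) = 1], which is the condition
   for lifting the Levi factor. *)
rewrite !det_mulmx det_umx det_lmx mul1r mulr1 det_ublock det_tr det_map_mx.
rewrite det_inv fmorphV => /(canRL (mulfVK _)).
rewrite mul1r fmorph_eq0 -unitfE -unitmxE uA => /(_ isT) dA.
apply: liftableM; last exact: liftable_umx.
apply: liftableM; first exact: liftable_lmx.
exact: liftable_levi.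
Qed.

End FixedSize.
End LiftUnitary.

(** * The subfield [F(a)] and the evaluation with values in it *)

Section AdjoinField.
Variables (F K : fieldType) (iota : F -> K) (a : K).

Lemma adjoin_divring_closed : divring_closed (adjoin iota a).
Proof.
split=> [|x y|x y]; first by apply/asboolP=> S [S1].
  by move=> /asboolP Sx /asboolP Sy; apply/asboolP=> S Sdiv SF Sa;
     case: (Sdiv) => _ SB _; apply: SB; [apply: Sx | apply: Sy].
by move=> /asboolP Sx /asboolP Sy; apply/asboolP=> S Sdiv SF Sa;
   case: (Sdiv) => _ _ SV; apply: SV; [apply: Sx | apply: Sy].
Qed.

HB.instance Definition _ :=
  GRing.isDivringClosed.Build K (adjoin iota a) adjoin_divring_closed.

(** [F(a)] as a field in its own right: evaluation is to be surjective onto the whole target of the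
    lifting argument, and [K] is too large for that. *)
Record adjoin_field :=
  AdjoinField { adjoin_val :> K; adjoin_valP : adjoin_val \in adjoin iota a }.

HB.instance Definition _ := [isSub for adjoin_val].
HB.instance Definition _ := [Choice of adjoin_field by <:].
HB.instance Definition _ :=
  [SubChoice_isSubIntegralDomain of adjoin_field by <:].
HB.instance Definition _ :=
  [SubIntegralDomain_isSubField of adjoin_field by <:].

Lemma base_adjoin c : iota c \in adjoin iota a.
Proof. by apply/asboolP=> S _ /(_ c). Qed.

Lemma gen_adjoin : a \in adjoin iota a.
Proof. by apply/asboolP. Qed.

Lemma laurent_eval_adjoin f : laurent_eval iota a f \in adjoin iota a.
Proof.
apply: rpred_sum => k _; apply: rpredM; first exact: base_adjoin.
by case: k => k; rewrite ?NegzE -?exprnP -?exprnN ?rpredV rpredX ?gen_adjoin.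
Qed.

Lemma mxOver_adjoin m n (A : 'M[K]_(m, n)) :
  A \is a mxOver (adjoin iota a) ->
  exists B : 'M[adjoin_field]_(m, n), map_mx val B = A.
Proof.
move=> /mxOverP aA; exists (\matrix_(i, j) AdjoinField (aA i j)).
by apply/matrixP=> i j; rewrite !mxE.
Qed.

End AdjoinField.

Section AdjoinEval.
Variables (F K : fieldType) (iota : {rmorphism F -> K}) (a : K).
Hypothesis a_neq0 : a != 0.

(* The proof argument keys the ring morphism structure, which fails at a = 0. *)
Definition adjoin_eval of a != 0 := fun f : laurent F =>
  AdjoinField (laurent_eval_adjoin iota a f).

Lemma adjoin_eval_nmod : nmod_morphism (adjoin_eval a_neq0).
Proof.
have [ev0 evD] := laurent_eval_nmod iota a.
by split=> [|f g]; apply: val_inj; rewrite /= ?rmorph0 ?rmorphD.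
Qed.

Lemma adjoin_eval_monoid : monoid_morphism (adjoin_eval a_neq0).
Proof.
have [ev1 evM] := laurent_eval_monoid iota a_neq0.
by split=> [|f g]; apply: val_inj; rewrite /= ?rmorph1 ?rmorphM.
Qed.

HB.instance Definition _ := GRing.isNmodMorphism.Build (laurent F)
  (adjoin_field iota a) (adjoin_eval a_neq0) adjoin_eval_nmod.
HB.instance Definition _ := GRing.isMonoidMorphism.Build (laurent F)
  (adjoin_field iota a) (adjoin_eval a_neq0) adjoin_eval_monoid.

End AdjoinEval.

(** * Powers of the Frobenius endomorphism *)

Section PowerFrobenius.
Variables (R : comNzRingType) (r : nat).
Hypothesis rP : [pchar R].-nat r.

(** The proof argument keys the morphism structure, since additivity of the power map rests on
    it. *)
Definition powFrobenius of [pchar R].-nat r := fun x : R => x ^+ r.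

Lemma powFrobenius_nmod : nmod_morphism (powFrobenius rP).
Proof.
split=> [|x y]; last exact: exprDn_pchar.
by rewrite /powFrobenius expr0n; case: r rP.
Qed.

Lemma powFrobenius_monoid : monoid_morphism (powFrobenius rP).
Proof. by split=> [|x y]; [apply: expr1n | apply: exprMn]. Qed.

HB.instance Definition _ :=
  GRing.isNmodMorphism.Build R R (powFrobenius rP) powFrobenius_nmod.
HB.instance Definition _ :=
  GRing.isMonoidMorphism.Build R R (powFrobenius rP) powFrobenius_monoid.

End PowerFrobenius.

Lemma pchar_nat_card (F : finFieldType) (R : nzRingType)
    (iota : {rmorphism F -> R}) :
  [pchar R].-nat #|F|.
Proof.
have [p p_pr pF] := finPcharP F.
have := pprimeChar_pgroup pF; rewrite /pgroup cardsT.
by rewrite (eq_pnat _ (fmorph_pchar iota)) (eq_pnat _ (pcharf_eq pF)).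
Qed.

(** Serves both for the specialization to [F(a)] and for the inclusion of [F(a)] in [K]. *)
Lemma sform_map (R S : comNzRingType) (f : {rmorphism R -> S})
    (barR : R -> R) (barS : S -> S) c n (x y : 'cV_(n + n)) :
  (forall z, f (barR z) = barS (f z)) ->
  sform barS (f c) (map_mx f x) (map_mx f y) = f (sform barR c x y).
Proof.
move=> f_bar; rewrite /sform.
have -> : map_mx barS (map_mx f y) = map_mx f (map_mx barR y).
  by apply/matrixP=> i j; rewrite !mxE f_bar.
have -> : block_mx 0 (f c)%:M 1%:M 0 =
    map_mx f (block_mx 0 c%:M 1%:M 0) :> 'M_(n + n).
  by rewrite map_block_mx !map_mx0 map_mx1 map_scalar_mx.
by rewrite map_trmx -!map_mxM mxE.
Qed.

(** * Evaluation at a primitive root of unity of order [r + 1] *)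

Section Specialization.
Variables (F : finFieldType) (K : fieldType) (iota : {rmorphism F -> K}).
Variables (s : nat) (a : K).
Hypotheses (s_gt0 : (0 < s)%N) (ha : (#|F| ^ s + 1)%N.-primitive_root a).

Let r := (#|F| ^ s)%N.

Let r_gt1 : (1 < r)%N.
Proof. by rewrite -(expn0 #|F|) ltn_exp2l // finNzRing_gt1. Qed.

Let a_r : a ^+ r = a^-1.
Proof.
have := prim_expr_order ha; rewrite addn1 exprSr => /(canRL (mulfK _)) ->.
  by rewrite mul1r.
apply/eqP=> a0; have := prim_expr_order ha.
by rewrite a0 addn1 expr0n => /eqP; rewrite eq_sym oner_eq0.
Qed.

Lemma prim_root_neq0 : a != 0.
Proof.
apply: contra_eq_neq (prim_expr_order ha) => a0.
by rewrite a0 addn1 expr0n eq_sym oner_neq0.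
Qed.

(** The order [r + 1] of [a] exceeds 2. This excludes both [a = 1] and [a = -1], where [1 - a^-1]
    and [1 + a] would vanish. *)
Let a_sqr_neq1 : a ^+ 2 != 1.
Proof.
rewrite -(prim_order_dvd ha); apply: contraTN r_gt1 => /dvdn_leq.
by move=> /(_ isT); rewrite -/r addn1 ltnS -leqNgt.
Qed.

Lemma prim_root_neq1 : a != 1.
Proof. by apply: contraNneq a_sqr_neq1 => ->; rewrite expr1n. Qed.

Lemma prim_root_neqN1 : 1 + a != 0.
Proof.
apply: contraNneq a_sqr_neq1 => /eqP; rewrite addrC addr_eq0 => /eqP->.
by rewrite sqrrN expr1n.
Qed.

Let pchar_r (E : nzRingType) (f : {rmorphism F -> E}) : [pchar E].-nat r.
Proof. by rewrite pnatX pchar_nat_card. Qed.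

(** Raising to the power [r] fixes the coefficients, which come from [F], is additive, and inverts
    [a]. *)
Lemma laurent_eval_conj f :
  laurent_eval iota a (laurent_conj f) = laurent_eval iota a f ^+ r.
Proof.
have [ev0 evD] := laurent_eval_nmod iota a.
elim/laurent_ind: f => [|f g IHf IHg|c k].
- by rewrite rmorph0 ev0 expr0n; case: r r_gt1.
- by rewrite rmorphD !evD IHf IHg exprDn_pchar ?pchar_r.
rewrite laurent_conj_lmono !laurent_eval_lmono exprMn -rmorphXn.
have -> : c ^+ r = c.
  by rewrite /r; elim: s => [|m IHm]; rewrite ?expr1 // expnS exprM expf_card.
by rewrite [_ ^+ r]exprnP exprzAC -exprnP a_r exprz_inv.
Qed.

(** The values of Laurent polynomials at [a] already form a field containing [F] and [a], so they
    exhaust the smallest one. *)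
Lemma adjoin_eval_surj (x : adjoin_field iota a) :
  exists f, adjoin_eval iota prim_root_neq0 f = x.
Proof.
have [ev0 evD] := laurent_eval_nmod iota a.
have evB f g :
    laurent_eval iota a (f - g) = laurent_eval iota a f - laurent_eval iota a g.
  by apply/eqP; rewrite eq_sym subr_eq -evD subrK.
have [ev1 evM] := laurent_eval_monoid iota prim_root_neq0.
have /asboolP/(_ (fun y => `[< exists f, laurent_eval iota a f = y >])) :=
  adjoin_valP x.
have evX f m : laurent_eval iota a (f ^+ m) = laurent_eval iota a f ^+ m.
  by elim: m => [|m IHm]; rewrite ?ev1 // !exprS evM IHm.
case/(_ _ _ _)/asboolP=> [|c||f evf].
- split=> [|y z|y z]; first by apply/asboolP; exists 1.
    by move=> /asboolP[f <-] /asboolP[g <-]; apply/asboolP; exists (f - g).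
  move=> /asboolP[f <-] /asboolP[g <-]; apply/asboolP.
  have [g0|g_neq0] := eqVneq (laurent_eval iota a g) 0.
    by exists 0; rewrite ev0 g0 invr0 mulr0.
  (* Applying [laurent_eval_conj] twice to [g] shows that its value [y] satisfies
     [y ^+ (r * r) = y]; for nonzero [y] the inverse is thus the power [r * r - 2]. *)
  exists (f * g ^+ (r * r - 2)); rewrite evM evX; congr (_ * _).
  have r2 : (1 < r * r)%N by rewrite (ltn_trans r_gt1) // ltn_Pmull // ltnW.
  apply: (mulfI g_neq0); apply: (mulfI g_neq0).
  rewrite mulfV // mulr1 mulrA -expr2 -exprD subnKC //.
  by rewrite exprM -!laurent_eval_conj laurent_conjK.
- by apply/asboolP; exists (lmono c 0); rewrite laurent_eval_lmono expr0z mulr1.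
- apply/asboolP; exists (laurentX F).
  by rewrite laurent_eval_lmono rmorph1 mul1r expr1z.
by exists f; apply: val_inj.
Qed.

End Specialization.

(** * Transfer between [F(a)] and [K], and the equality of the two groups *)

Theorem lemma2p2 (q : nat) (F : finFieldType) (hq : #|F| = q)
  (K : closedFieldType) (iota : {rmorphism F -> K})
  (hK : forall x : K, algebraicOver iota x)
  (n s : nat) (hn : (0 < n)%N) (hs : (0 < s)%N)
  (a : K) (ha : (q ^ s + 1)%N.-primitive_root a) :
  map_mx (laurent_eval iota a) @` Gtau F n = SU iota a n (q ^ s).
Proof.
subst q.
pose E := adjoin_field iota a; pose r := (#|F| ^ s)%N.
pose ev : {rmorphism laurent F -> E} := adjoin_eval iota (prim_root_neq0 ha).
pose v : {rmorphism E -> K} := (val : E -> K).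
pose aE : E := AdjoinField (gen_adjoin iota a).
have evE m1 m2 (A : 'M_(m1, m2)) :
    map_mx (laurent_eval iota a) A = map_mx v (map_mx ev A).
  by apply/matrixP=> i j; rewrite !mxE.
have evX : ev (laurentX F) = aE.
  by apply: val_inj; rewrite /= laurent_eval_lmono rmorph1 mul1r expr1z.
have rP : [pchar E].-nat r.
  by rewrite pnatX -(eq_pnat _ (fmorph_pchar v)) (pchar_nat_card iota).
pose bar : {rmorphism E -> E} := powFrobenius rP.
have v_bar z : v (bar z) = v z ^+ r by exact: (rmorphXn v).
have ev_bar f : ev (laurent_conj f) = bar (ev f).
  by apply: val_inj; rewrite [RHS]v_bar; exact: laurent_eval_conj.
have ev_surj (x : E) : exists f, ev f = x := adjoin_eval_surj hs ha x.
have sformE (x y : 'cV[E]_(n + n)) :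
    sform (fun z => z ^+ r) a (map_mx v x) (map_mx v y) =
    v (sform bar aE x y).
  exact: (@sform_map E K v bar _ aE n x y v_bar).
apply/seteqP; split=> [_ [G [dG UG] <-]|g [ga dg Ug]].
  rewrite evE; split; last 1 first.
  - move=> _ _ /mxOver_adjoin[x <-] /mxOver_adjoin[y <-].
    (* Vectors over [F(a)] lift to Laurent polynomial vectors, where invariance of the form under
       [G] is known. *)
    have [X <-] := map_mx_surj ev_surj x; have [Y <-] := map_mx_surj ev_surj y.
    rewrite -!map_mxM [LHS]sformE [RHS]sformE -evX; congr (v _).
    by rewrite !(sform_map _ _ _ ev_bar) UG.
  - by apply/mxOverP=> i j; rewrite !mxE; apply: adjoin_valP.
  by rewrite !det_map_mx dG !rmorph1.
have [h hE] := mxOver_adjoin ga.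
have dh : \det h = 1.
  by apply: (fmorph_inj v); rewrite -det_map_mx rmorph1 -dg -hE.
have Uh : unitary bar aE h.
  apply: sform_unitary => i j; apply: (fmorph_inj v).
  (* The invariance in [SU] is given only for vectors over [F(a)]; the basis vectors are among
     them. *)
  have oD k : map_mx v (delta_mx k (0 : 'I_1) : 'cV_(n + n))
      \is a mxOver (adjoin iota a).
    by apply/mxOverP=> i' j'; rewrite mxE; apply: adjoin_valP.
  have := Ug _ _ (oD i) (oD j).
  by rewrite -hE -!map_mxM !sformE.
have XV : laurentX F * lmono 1 (-1) = 1 by rewrite lmonoM mulr1 subrr.
have conjX : laurent_conj (laurentX F) = lmono 1 (-1).
  by rewrite laurent_conj_lmono.
have [||G [dG UG] Gh] :=
  unitary_lift (@laurent_conjK F) XV conjX ev_surj evX ev_bar _ _ dh Uh.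
- by rewrite -(inj_eq val_inj) /= (prim_root_neq1 hs ha).
- by rewrite -(inj_eq val_inj) /= (prim_root_neqN1 hs ha).
exists G; last by rewrite evE Gh.
split; first exact: dG.
move=> x y.
exact: (@unitary_sform (laurent F) (@laurent_conj F) _ n G x y UG).
Qed.
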